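(* Suppose that $S\in M_n(\mathbb C)$ is a bilateral weighted shift matrix. Then there is a normal matrix $N\in M_n(\mathbb C)$ such that $$\|N-S\|\le C_\alpha\,\|S\|^{1-2\alpha}\,\|[S^\ast,S]\|^{\alpha}$$ for $\alpha=1/3$ and a constant $C_{1/3}<5.3308$ (independent of $n$ and $S$). Further, $N$ is unitarily equivalent to a direct sum of bilateral weighted shift operators, $\|N\|\le\|S\|$, and if $S$ is real then $N$ is real. If $\sigma>0$ and the weights of $S$ all have absolute value at least $\sigma$, then a normal matrix $N\in M_n(\mathbb C)$ can be chosen such that $N$ is unitarily equivalent to a direct sum of bilateral weighted shift operators, $\|N\|\le\|S\|$, $N$ is real if $S$ is real, and $N$ satisfies the alternate estimate $$\|N-S\|\le 4.8573\,\sqrt{\frac{\|S\|}{\sigma}}\;\|[S^\ast,S]\|^{1/2}.$$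
   Context: $\|\cdot\|$ is the operator norm and $[X,Y]=XY-YX$. A bilateral weighted shift operator with weights $c_1,\dots,c_n\in\mathbb C$ with respect to an orthonormal basis $v_1,\dots,v_n$ is the linear operator $T$ with $Tv_i=c_iv_{i+1}$ for $1\le i\le n$, indices taken cyclically ($v_{n+1}=v_1$). A bilateral weighted shift matrix in $M_n(\mathbb C)$ is such an operator with respect to the standard basis of $\mathbb C^n$. A matrix is real if its entries are real. *)

(* Defs.v *)
From mathcomp Require Import all_boot all_order all_algebra.
From mathcomp Require Import spectral complex.
From mathcomp Require Import boolp classical_sets reals exp.

Set Implicit Arguments.
Unset Strict Implicit.
Unset Printing Implicit Defensive.

Import Order.TTheory GRing.Theory Num.Theory.
Local Open Scope ring_scope.
Local Open Scope complex_scope.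
Local Open Scope sesquilinear_scope.
Local Open Scope classical_set_scope.

Section Definitions.
Variable R : realType.

Definition l2norm n (x : 'cV[R[i]]_n) : R :=
  Num.sqrt (\sum_(i < n) Normc.normc (x i 0) ^+ 2).

Definition opnorm n (A : 'M[R[i]]_n) : R :=
  sup [set l2norm (A *m x) | x in [set x : 'cV[R[i]]_n | l2norm x <= 1]].

Definition commutator n (A B : 'M[R[i]]_n) : 'M[R[i]]_n := A *m B - B *m A.

(* n orthonormal vectors of C^n automatically form a basis. *)
Definition orthonormal_basis n (v : 'I_n -> 'cV[R[i]]_n) : Prop :=
  forall j k, (v j)^t* *m v k = (j == k)%:R%:M.

(* ordS is the cyclic successor on 'I_n; for n = 1 this reads T v = c v. *)
Definition weighted_shift_wrt n (v : 'I_n -> 'cV[R[i]]_n) (c : 'I_n -> R[i])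
    (T : 'M[R[i]]_n) : Prop :=
  forall j, T *m v j = c j *: v (ordS j).

Definition weighted_shift_operator n (T : 'M[R[i]]_n) : Prop :=
  exists v c, orthonormal_basis v /\ weighted_shift_wrt v c T.

Definition std_basis n (j : 'I_n) : 'cV[R[i]]_n := delta_mx j 0.

Definition weighted_shift_matrix n (c : 'I_n -> R[i]) (S : 'M[R[i]]_n) : Prop :=
  weighted_shift_wrt (@std_basis n) c S.

(* Orthonormality of both the rows and the columns of U forces m = n; allowing
   m and n to be different expressions avoids casts between matrix types. *)
Definition unitarily_equivalent m n (A : 'M[R[i]]_m) (B : 'M[R[i]]_n) : Prop :=
  exists U : 'M[R[i]]_(m, n),
    [/\ U \is unitarymx, U^t* \is unitarymx & B = U^t* *m A *m U].

Definition equiv_sum_of_weighted_shifts n (N : 'M[R[i]]_n) : Prop :=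
  exists (k : nat) (p : 'I_k -> nat) (B : forall j, 'M[R[i]]_(p j)),
    [/\ forall j, (0 < p j)%N,
        forall j, weighted_shift_operator (B j)
      & unitarily_equivalent (mxdiag B) N].

End Definitions.

(* Main.v *)
(* Idea.  Let [a_j] be the moduli of the weights.  The commutator is diagonal
   with entries [a_j^2 - a_{j-1}^2], so [a] varies slowly along the cycle.
   Quantise it with hysteresis: [b] jumps by [+-s] only when [|a - b|] reaches
   [s], hence consecutive jumps are far apart.  Around the cycle every level is
   crossed upwards as often as downwards, so the jumps can be paired, each up
   with a down at the same level.  On the [m] steps leading to two paired jumps
   the two streams are gradually exchanged (Berg's technique) by 2 x 2
   reflections that turn from diag(1,-1) to the swap.  In the turned basis every
   orbit of the rerouted shift carries a constant weight [b], so the new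
   operator [N] is normal; it differs from [S] by [O(s)] for the weights and
   [O(|S| / m)] for the turning, with [s = (m + 1) eta] where [eta] is the
   Lipschitz constant of [a], and [m] balances the two.  For the
   first estimate the moduli are first raised to a threshold of order
   [(|S| |[S^*,S]|)^(1/3)]. *)
Require Import Defs.
From mathcomp Require Import all_boot all_order all_algebra.
From mathcomp Require Import spectral complex.
From mathcomp Require Import boolp classical_sets reals exp.
From mathcomp Require Import ring lra zify.

Set Implicit Arguments.
Unset Strict Implicit.
Unset Printing Implicit Defensive.

Import Order.TTheory GRing.Theory Num.Theory.
Local Open Scope ring_scope.
Local Open Scope complex_scope.
Local Open Scope sesquilinear_scope.

(** * The Euclidean norm and the operator norm *)

Section OperatorNorm.
Variable R : realType.
Local Notation C := R[i].
Local Notation normc := Normc.normc.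

Lemma normc_normr (z : C) : (normc z)%:C = `|z|.
Proof. by case: z. Qed.

Lemma normc_ge0 (z : C) : 0 <= normc z.
Proof. by case: z => x y; rewrite sqrtr_ge0. Qed.

Lemma normc_real (x : R) : normc x%:C = `|x|.
Proof. by rewrite /= expr0n /= addr0 sqrtr_sqr. Qed.

Lemma sqr_l2norm n (x : 'cV[C]_n) : l2norm x ^+ 2 = \sum_i normc (x i 0) ^+ 2.
Proof. by rewrite sqr_sqrtr // sumr_ge0 // => i _; rewrite sqr_ge0. Qed.

Lemma l2norm_ge0 n (x : 'cV[C]_n) : 0 <= l2norm x.
Proof. exact: sqrtr_ge0. Qed.

Lemma l2norm_le n (x : 'cV[C]_n) r :
  0 <= r -> \sum_i normc (x i 0) ^+ 2 <= r ^+ 2 -> l2norm x <= r.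
Proof.
by move=> r0 h; rewrite -[r](ger0_norm r0) -sqrtr_sqr ler_sqrt // sqr_ge0.
Qed.

Lemma l2norm0 n : l2norm (0 : 'cV[C]_n) = 0.
Proof.
by rewrite /l2norm big1 ?sqrtr0 // => i _; rewrite mxE Normc.normc0 expr0n.
Qed.

Lemma l2norm_eq0 n (x : 'cV[C]_n) : l2norm x = 0 -> x = 0.
Proof.
move=> x0; apply/matrixP => i j; rewrite ord1 mxE; apply: Normc.eq0_normc.
have /eqP : \sum_i normc (x i 0) ^+ 2 = 0 by rewrite -sqr_l2norm x0 expr0n.
rewrite psumr_eq0; last by move=> k _; rewrite sqr_ge0.
by move=> /allP /(_ i (mem_index_enum _)) /=; rewrite sqrf_eq0 => /eqP.
Qed.

Lemma l2normD n (x y : 'cV[C]_n) : l2norm (x + y) <= l2norm x + l2norm y.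
Proof.
have [x0|/eqP x0] := eqVneq (l2norm x) 0.
  by rewrite x0 (l2norm_eq0 x0) !add0r.
have [y0|/eqP y0] := eqVneq (l2norm y) 0.
  by rewrite y0 (l2norm_eq0 y0) !addr0.
have {}x0 : 0 < l2norm x by rewrite lt0r l2norm_ge0 andbT; apply/eqP.
have {}y0 : 0 < l2norm y by rewrite lt0r l2norm_ge0 andbT; apply/eqP.
set u := l2norm x in x0 *; set v := l2norm y in y0 *.
apply: l2norm_le; first by rewrite addr_ge0 // ltW.
(* The claim then follows termwise from [(p + q)^2 <= (u + v) / u p^2 + (u + v) / v q^2], whose
   defect is the square [(v p - u q)^2 / (u v)]. *)
have -> : (u + v) ^+ 2 =
    (u + v) / u * \sum_i normc (x i 0) ^+ 2
    + (u + v) / v * \sum_i normc (y i 0) ^+ 2.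
  by rewrite -!sqr_l2norm -/u -/v; field; rewrite !gt_eqF.
rewrite !big_distrr -big_split /=; apply: ler_sum => i _; rewrite mxE.
set p := normc (x i 0); set q := normc (y i 0).
apply: (@le_trans _ _ ((p + q) ^+ 2)).
  by rewrite lerXn2r ?nnegrE ?addr_ge0 ?normc_ge0 // le_normcD.
rewrite -subr_ge0.
have -> : (u + v) / u * p ^+ 2 + (u + v) / v * q ^+ 2 - (p + q) ^+ 2
   = (v * p - u * q) ^+ 2 / (u * v) by field; rewrite !gt_eqF.
by rewrite divr_ge0 ?sqr_ge0 // mulr_ge0 // ltW.
Qed.

Lemma l2normZ n (a : C) (x : 'cV[C]_n) : l2norm (a *: x) = normc a * l2norm x.
Proof.
rewrite /l2norm -[normc a]ger0_norm ?normc_ge0 // -sqrtr_sqr -sqrtrM ?sqr_ge0 //.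
congr Num.sqrt; rewrite big_distrr; apply: eq_bigr => i _.
by rewrite mxE Normc.normcM exprMn.
Qed.

Lemma l2norm_delta n (j : 'I_n) : l2norm (delta_mx j 0 : 'cV[C]_n) = 1.
Proof.
rewrite /l2norm (bigD1 j) //= big1 => [|i ij]; rewrite mxE.
  by rewrite !eqxx Normc.normc1 expr1n addr0 sqrtr1.
by rewrite (negPf ij) Normc.normc0 expr0n.
Qed.

Lemma normc_le_l2norm n (x : 'cV[C]_n) i : normc (x i 0) <= l2norm x.
Proof.
rewrite -[normc _]ger0_norm ?normc_ge0 // -sqrtr_sqr ler_wsqrtr //.
rewrite (bigD1 i) //= lerDl sumr_ge0 // => j _; exact: sqr_ge0.
Qed.

Lemma mulmx_delta_col n (A : 'M[C]_n) j : A *m delta_mx j 0 = col j A.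
Proof. by rewrite colE. Qed.

(** A crude bound, used to see that the supremum defining [opnorm] is taken over a bounded set. *)
Lemma mulmx_bounded n (A : 'M[C]_n) x :
  l2norm (A *m x) <= (\sum_j l2norm (col j A)) * l2norm x.
Proof.
have -> : A *m x = \sum_j x j 0 *: col j A.
  apply/matrixP => i k; rewrite ord1 mxE summxE; apply: eq_bigr => j _.
  by rewrite !mxE mulrC.
rewrite big_distrl /=.
elim/big_ind2 : _ => [|u a v b ua vb|j _]; first by rewrite l2norm0.
  by rewrite (le_trans (l2normD _ _)) // lerD.
by rewrite l2normZ mulrC ler_wpM2l ?l2norm_ge0 ?normc_le_l2norm.
Qed.

Lemma opnorm_le n (A : 'M[C]_n) r : 0 <= r ->
  (forall x, l2norm (A *m x) <= r * l2norm x) -> opnorm A <= r.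
Proof.
move=> r0 Ar; apply: ge_sup.
  by exists (l2norm (A *m 0)), 0 => //=; rewrite l2norm0 ler01.
by move=> _ [x /= x1 <-]; rewrite (le_trans (Ar x)) // ler_piMr.
Qed.

Lemma opnorm_ub n (A : 'M[C]_n) x :
  l2norm (A *m x) <= opnorm A * l2norm x.
Proof.
have [x0|/eqP x0] := eqVneq (l2norm x) 0.
  by rewrite (l2norm_eq0 x0) mulmx0 l2norm0 mulr0.
have {}x0 : 0 < l2norm x by rewrite lt0r l2norm_ge0 andbT; apply/eqP.
rewrite -ler_pdivrMr //.
have nV : normc (l2norm x)^-1%:C = (l2norm x)^-1.
  by rewrite normc_real ger0_norm // invr_ge0 ltW.
have -> : l2norm (A *m x) / l2norm x = l2norm (A *m ((l2norm x)^-1%:C *: x)).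
  by rewrite -scalemxAr l2normZ nV mulrC.
apply: ub_le_sup.
  exists (\sum_j l2norm (col j A)) => _ [y /= y1 <-].
  rewrite (le_trans (mulmx_bounded _ _)) // ler_piMr //.
  by rewrite sumr_ge0 // => j _; exact: l2norm_ge0.
by exists ((l2norm x)^-1%:C *: x) => //=; rewrite l2normZ nV mulVf ?gt_eqF.
Qed.

Lemma opnorm_ge0 n (A : 'M[C]_n) : 0 <= opnorm A.
Proof.
case: n A => [|n] A; last first.
  apply: le_trans (l2norm_ge0 (A *m delta_mx 0 0)) _.
  by rewrite (le_trans (opnorm_ub _ _)) // l2norm_delta mulr1.
have -> : A = 0 by apply/matrixP => - [].
apply: ub_le_sup; last by exists 0; rewrite /= ?mulmx0 ?l2norm0.
by exists 0 => _ [y _ <-]; rewrite mul0mx l2norm0.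
Qed.

Lemma normc_le_opnorm n (A : 'M[C]_n) i j : normc (A i j) <= opnorm A.
Proof.
have := opnorm_ub A (delta_mx j 0); rewrite l2norm_delta mulr1.
apply: le_trans; rewrite mulmx_delta_col.
by have := normc_le_l2norm (col j A) i; rewrite mxE.
Qed.

Lemma opnorm_eq0 n (A : 'M[C]_n) : opnorm A = 0 -> A = 0.
Proof.
move=> A0; apply/matrixP => i j; rewrite mxE; apply: Normc.eq0_normc.
by apply/eqP; rewrite eq_le normc_ge0 andbT -A0 normc_le_opnorm.
Qed.

Lemma opnorm0 n : opnorm (0 : 'M[C]_n) = 0.
Proof.
apply/eqP; rewrite eq_le opnorm_ge0 andbT; apply: opnorm_le => // x.
by rewrite mul0mx l2norm0 mul0r.
Qed.

Lemma opnormD n (A B : 'M[C]_n) : opnorm (A + B) <= opnorm A + opnorm B.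
Proof.
apply: opnorm_le => [|x]; first by rewrite addr_ge0 ?opnorm_ge0.
rewrite mulmxDl (le_trans (l2normD _ _)) // mulrDl lerD //; exact: opnorm_ub.
Qed.

Lemma opnormM n (A B : 'M[C]_n) : opnorm (A *m B) <= opnorm A * opnorm B.
Proof.
apply: opnorm_le => [|x]; first by rewrite mulr_ge0 ?opnorm_ge0.
rewrite -mulmxA (le_trans (opnorm_ub _ _)) // -mulrA.
by rewrite ler_wpM2l ?opnorm_ge0 ?opnorm_ub.
Qed.

Lemma opnormN n (A : 'M[C]_n) : opnorm (- A) = opnorm A.
Proof.
have h (B : 'M[C]_n) : opnorm (- B) <= opnorm B.
  apply: opnorm_le => [|x]; first exact: opnorm_ge0.
  by rewrite mulNmx -scaleN1r l2normZ normcN Normc.normc1 mul1r opnorm_ub.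
by apply/eqP; rewrite eq_le h -{1}[A]opprK h.
Qed.

(** An inequality only, since for [n = 0] the norm is 0. *)
Lemma opnorm_isometry_le n (U : 'M[C]_n) : U^t* *m U = 1%:M -> opnorm U <= 1.
Proof.
have sq (x : 'cV[C]_n) : (l2norm x ^+ 2)%:C = (x^t* *m x) 0 0.
  rewrite sqr_l2norm rmorph_sum /= mxE; apply: eq_bigr => i _.
  by rewrite !mxE rmorphXn /= normc_normr normCK mulrC.
move=> UU; apply: opnorm_le => // x; rewrite mul1r.
suff -> : l2norm (U *m x) = l2norm x by [].
apply/eqP; rewrite -(@eqrXn2 _ 2) ?l2norm_ge0 //; apply/eqP.
apply: complexI; rewrite !sq trmx_mul map_mxM /= -mulmxA [X in _ *m X]mulmxA.
by rewrite UU mul1mx.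
Qed.

Lemma opnorm_diag_le n (d : 'I_n -> C) r : 0 <= r ->
  (forall i, normc (d i) <= r) -> opnorm (diag_mx (\row_i d i)) <= r.
Proof.
move=> r0 dr; apply: opnorm_le => // x; apply: l2norm_le.
  by rewrite mulr_ge0 ?l2norm_ge0.
rewrite exprMn sqr_l2norm big_distrr; apply: ler_sum => i _ /=.
rewrite mul_diag_mx !mxE Normc.normcM exprMn.
by rewrite ler_wpM2r ?sqr_ge0 // lerXn2r ?nnegrE ?normc_ge0.
Qed.

End OperatorNorm.

(** * Pairing up-crossings with down-crossings on a cycle *)

Section Pairing.
Variables (T : finType) (f : T -> int) (g : T -> T).
Hypotheses (g_inj : injective g) (step : forall v, `|f (g v) - f v| <= 1).

Let E p q := [set v | (f v == p) && (f (g v) == q)].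

(** The set where [f] exceeds [p] and its preimage under the bijection [g] have the same size, hence
    so have their two differences. As [f] moves by at most 1, these are the crossings between [p]
    and [p + 1] in the two directions. *)
Let card_E_succ p : #|E p (p + 1)| = #|E (p + 1) p|.
Proof.
pose A := [set v | p < f v]; pose B := [set v | p < f (g v)].
have AB : #|B| = #|A|.
  have -> : B = g @^-1: A by apply/setP => v; rewrite !inE.
  by rewrite on_card_preimset //; exact: onW_bij (injF_bij g_inj).
have AE : A :\: B = E (p + 1) p.
  apply/setP => v; rewrite !inE; have := step v; lia.
have BE : B :\: A = E p (p + 1).
  apply/setP => v; rewrite !inE; have := step v; lia.
have := cardsID A B; have := cardsID B A.
by rewrite finset.setIC AE BE AB => <- /eqP; rewrite eqn_add2l => /eqP.
Qed.

Let card_E p q : #|E p q| = #|E q p|.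
Proof.
have [->|pq] := eqVneq p q; first by [].
have [->|pq1] := eqVneq q (p + 1); first exact: card_E_succ.
have [->|pq2] := eqVneq p (q + 1); first by rewrite card_E_succ.
have E0 r t : r != t -> t != r + 1 -> r != t + 1 -> E r t = finset.set0.
  by move=> *; apply/setP => v; rewrite !inE; have := step v; lia.
by rewrite !E0 // eq_sym.
Qed.

(* Around the cycle every value is crossed upwards as often as downwards. *)
Lemma crossing_pairing : exists r : T -> T,
  [/\ involutive r, forall v, f (r v) = f (g v)
    & forall v, f (g (r v)) = f v].
Proof.
(* With [p = f v] and [q = f (g v)], the k-th crossing from [p] to [q] is sent to the k-th crossing
   from [q] to [p]. The default of [nth] is never reached, the two sets having the same size. *)
pose r v := nth v (enum (E (f (g v)) (f v))) (index v (enum (E (f v) (f (g v))))).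
have iE v : (index v (enum (E (f v) (f (g v)))) < #|E (f (g v)) (f v)|)%N.
  by rewrite card_E cardE index_mem mem_enum !inE !eqxx.
have rE v : r v \in E (f (g v)) (f v).
  by rewrite -mem_enum mem_nth // -cardE.
have fr v : f (r v) = f (g v) by have := rE v; rewrite !inE => /andP[/eqP].
have fgr v : f (g (r v)) = f v by have := rE v; rewrite !inE => /andP[_ /eqP].
exists r; split=> // v; rewrite {1}/r fr fgr index_uniq ?enum_uniq //.
  by rewrite nth_index // mem_enum !inE !eqxx.
by rewrite -cardE.
Qed.

End Pairing.

(** * Quantisation of a slowly varying sequence with hysteresis *)

Section Hysteresis.
Variables (R : realType) (A : nat -> R) (eta : R) (m : nat).
Hypotheses (eta_gt0 : 0 < eta) (m_gt0 : (0 < m)%N).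
Hypothesis lipA : forall i, `|A i.+1 - A i| <= eta.

Let s := m.+1%:R * eta.

Let s_gt : eta < s.
Proof. by rewrite /s ltr_pMl // ltr1n. Qed.

Definition jump (x : R) : int :=
  if s <= x then 1 else if x <= - s then - 1 else 0.

(** An integer level is recorded, so that [crossing_pairing] applies to it. The value subtracted
    from [A j.+1] is [quant j]. *)
Fixpoint level (i : nat) : int :=
  if i is j.+1 then level j + jump (A j.+1 - (A 0 + (level j)%:~R * s)) else 0.

Definition quant i := A 0 + (level i)%:~R * s.

(** The new input is tested against the old value, so [i] is the last index before the change. *)
Definition jumps i := s <= `|A i.+1 - quant i|.

Lemma levelS i : level i.+1 = level i + jump (A i.+1 - quant i).
Proof. by []. Qed.

Lemma quantS i : quant i.+1 = quant i + (jump (A i.+1 - quant i))%:~R * s.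
Proof. by rewrite /quant levelS rmorphD /= mulrDl addrA. Qed.

Lemma level_step i : `|level i.+1 - level i| <= 1.
Proof. by rewrite levelS addrC addKr /jump; case: ifP => // _; case: ifP. Qed.

Lemma level_stepE i : (level i.+1 != level i) = jumps i.
Proof.
rewrite levelS -subr_eq0 addrC addKr /jump /jumps ler_normr [s <= - _]lerNr.
by case: ifP => //= _; case: ifP.
Qed.

Lemma quant_step i : `|quant i.+1 - quant i| <= s.
Proof.
rewrite quantS addrC addKr normrM -intr_norm [`|s|]gtr0_norm; last first.
  exact: lt_trans s_gt.
rewrite ler_piMl ?(ltW (lt_trans eta_gt0 s_gt)) //.
by rewrite /jump; case: ifP => // _; case: ifP.
Qed.

(** One step moves the input by at most [eta < s], so a discrepancy that reaches [s] is still below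
    [s + eta], and one jump brings it below [eta]. *)
Lemma quant_near i : `|A i - quant i| < s.
Proof.
elim: i => [|i IH]; first by rewrite /quant mul0r addr0 subrr normr0 (lt_trans eta_gt0).
move: IH (lipA i) s_gt; rewrite quantS /jump !ltr_norml !ler_norml.
move=> /andP[? ?] /andP[? ?] ?.
case: ifP => [?|/negbT]; first by rewrite mul1r; lra.
rewrite -ltNge => ?.
case: ifP => [?|/negbT]; first by rewrite mulN1r; lra.
by rewrite -ltNge => ?; rewrite mul0r; lra.
Qed.

Lemma quant_after_jump i : jumps i -> `|A i.+1 - quant i.+1| <= eta.
Proof.
move: (quant_near i) (lipA i) s_gt; rewrite /jumps quantS /jump ltr_norml !ler_norml ler_normr.
move=> /andP[? ?] /andP[? ?] ?.
case: ifP => [?|/negbT]; first by rewrite mul1r; lra.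
rewrite -ltNge => ? /orP[?|?]; first by lra.
by rewrite lerNr ifT //; rewrite mulN1r; lra.
Qed.

Lemma lip_iter i j : `|A (i + j)%N - A i| <= j%:R * eta.
Proof.
elim: j => [|j IH]; first by rewrite addn0 subrr normr0 mul0r.
rewrite addnS -natr1 mulrDl mul1r.
have -> : A (i + j).+1 - A i = (A (i + j)%N - A i) + (A (i + j).+1 - A (i + j)%N).
  by ring.
by rewrite (le_trans (ler_normD _ _)) // lerD.
Qed.

(* After a jump the input must travel a further [s - eta = m eta] before the
   next one, so consecutive jumps are at least [m] steps apart. *)
Lemma jump_separation t j : jumps t -> (j < m)%N ->
  [/\ (j <= t)%N, level (t - j) = level t & (0 < j)%N -> ~~ jumps (t - j)].
Proof.
move=> Jt; elim: j => [|j IH] jm; first by rewrite subn0.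
have [jt lj _] := IH (ltnW jm).
(* Going back [j + 1] steps from the jump, the input moves by at most [(j + 1) eta < s - eta]. The
   discrepancy at [t - j] therefore exceeds [eta], which excludes both the start, where it is 0, and
   an index just after a jump. *)
have far : eta < `|A (t - j)%N - quant t|.
  have := lip_iter (t - j)%N j.+1; rewrite addnS subnK // => h1.
  have h2 : `|A t.+1 - quant t| <= `|A t.+1 - A (t - j)%N| + `|A (t - j)%N - quant t|.
    exact: ler_distD.
  have h3 : j.+2%:R * eta < s by rewrite /s ltr_pM2r // ltr_nat.
  by move: Jt h1 h2 h3; rewrite /jumps -[j.+2%:R]natr1 mulrDl mul1r; lra.
have qj : quant (t - j) = quant t by rewrite /quant lj.
have jt' : (j < t)%N.
  rewrite ltn_neqAle jt andbT; apply/eqP => jE.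
  by move: far; rewrite -qj jE subnn /quant mul0r addr0 subrr normr0 ltNge ltW.
have nj : ~~ jumps (t - j.+1).
  apply/negP => /quant_after_jump.
  by rewrite -subSn // subSS qj leNgt far.
split=> //; rewrite -lj -[in RHS](subnSK jt'); apply/esym/eqP.
by rewrite -[_ == _]negbK level_stepE.
Qed.

(** The input at [t - j] is within [m eta] of the one at [t + 1], which is within [eta] of the new
    value. Here [s = (m + 1) eta] is spent: on a whole strip the value after the jump is as good a
    weight as the one before. *)
Lemma quant_strip t j : jumps t -> (j < m)%N -> `|A (t - j)%N - quant t.+1| <= s.
Proof.
move=> Jt jm; have [jt _ _] := jump_separation Jt jm.
have := lip_iter (t - j)%N j.+1; rewrite addnS subnK // => h1.
have h2 := quant_after_jump Jt.
have h3 : `|A (t - j)%N - quant t.+1| <= `|A t.+1 - A (t - j)%N| + `|A t.+1 - quant t.+1|.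
  by rewrite [`|A t.+1 - A _|]distrC ler_distD.
have h4 : j.+1%:R * eta <= m%:R * eta by rewrite ler_pM2r // ler_nat.
by rewrite /s -natr1 mulrDl mul1r; lra.
Qed.

(** The strict bound [quant_near] leaves an integer of modulus less than 1. So the quantisation
    closes up around the cycle. *)
Lemma level_period n : A n = A 0 -> level n = 0.
Proof.
move=> An; have := quant_near n.
rewrite /quant An opprD addrA subrr sub0r normrN normrM -intr_norm.
rewrite [`|s|]gtr0_norm ?(lt_trans eta_gt0) //.
rewrite -ltr_pdivlMr ?(lt_trans eta_gt0) // divff ?gt_eqF ?(lt_trans eta_gt0) //.
by rewrite -[1]/(1%:~R) ltr_int; lia.
Qed.

(** A jump goes towards the input and never past it. This later keeps the norm of [N] below that of
    [S]. *)
Lemma quant_bounds lo hi :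
  (forall i, lo <= A i <= hi) -> forall i, lo <= quant i <= hi.
Proof.
move=> h; elim=> [|i IH]; first by rewrite /quant mul0r addr0.
move: IH (h i.+1) (lt_trans eta_gt0 s_gt); rewrite quantS /jump.
move=> /andP[? ?] /andP[? ?] ?.
case: ifP => [?|_]; first by rewrite mul1r; lra.
case: ifP => [?|_]; first by rewrite mulN1r; lra.
by rewrite mul0r; lra.
Qed.

End Hysteresis.

(** * From the jumps to exchanged pairs of strips *)

Section ExchangePattern.
Variable R : realType.

(* [tau] exchanges the strips of [m] vertices preceding two paired jumps of
   [b]; [d] is the distance to the end of the strip, and [d v = m] off the
   strips. *)
Record exchange_pattern n (a : 'I_n -> R) (m : nat) (s : R)
    (tau : 'I_n -> 'I_n) (b : 'I_n -> R) (d : 'I_n -> nat) : Prop :=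
  ExchangePattern {
    xp_inv : involutive tau;
    xp_dist : forall v, d (tau v) = d v;
    xp_bounds : forall lo hi,
      (forall v, lo <= a v <= hi) -> forall v, lo <= b v <= hi;
    xp_near : forall v, `|a v - b v| <= s;
    xp_near_tau : forall v, `|a v - b (tau v)| <= s;
    xp_gap : forall v, `|b (tau v) - b v| <= s;
    xp_neq : forall v, (d v < m)%N -> b (tau v) != b v;
    xp_inner : forall v, (0 < d v < m)%N ->
      [/\ v.+1 < n, d (ordS v) = (d v).-1 & tau (ordS v) = ordS (tau v)]%N;
    xp_const : forall v, (0 < d v)%N -> b (ordS v) = b v;
    xp_outer : forall v, (m <= d v)%N -> (m.-1 <= d (ordS v))%N;
    xp_end : forall v, d v = 0%N ->
      (m.-1 <= d (ordS v))%N /\ b (ordS v) = b (tau v) }.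

(** The hysteresis is run once around the cycle from vertex 0 and the jumps are paired by
    [crossing_pairing]. Then [tau] sends a vertex of a strip to the vertex at the same distance
    before the paired jump. *)
Lemma exchange_pattern_exists n (a : 'I_n -> R) (eta : R) m :
  (0 < n)%N -> 0 < eta -> (0 < m)%N ->
  (forall v, `|a (ordS v) - a v| <= eta) ->
  exists tau b d, exchange_pattern a m (m.+1%:R * eta) tau b d.
Proof.
case: n a => // n a _ eta_gt0 m_gt0 lip.
pose A i := a (inord (i %% n.+1)).
have A_ord (v : 'I_n.+1) : A v = a v by rewrite /A modn_small // inord_val.
have ordSE (v : 'I_n.+1) i : i = v %[mod n.+1] -> ordS v = inord (i.+1 %% n.+1).
  by move=> iv; apply: val_inj; rewrite /= inordK ?ltn_pmod // -addn1 -modnDml -iv modnDml addn1.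
have lipA i : `|A i.+1 - A i| <= eta.
  have := lip (inord (i %% n.+1)); rewrite (@ordSE _ i) //.
  by rewrite inordK ?ltn_pmod // modn_mod.
set s := m.+1%:R * eta.
pose L := level A eta m; pose J := jumps A eta m; pose q := quant A eta m.
have LE i : (L i.+1 != L i) = J i := level_stepE A eta m i.
have sep t j : J t -> (j < m)%N ->
    [/\ (j <= t)%N, L (t - j)%N = L t & (0 < j)%N -> ~~ J (t - j)%N].
  exact: jump_separation.
have LnE : L n.+1 = 0.
  by apply: (level_period eta_gt0 m_gt0 lipA); rewrite /A modnn mod0n.
have LS (v : 'I_n.+1) : L (ordS v) = L v.+1.
  rewrite -[nat_of_ord (ordS v)]/(v.+1 %% n.+1)%N.
  have [vn|vn] := ltnP v.+1 n.+1; first by rewrite modn_small.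
  have -> : v.+1 = n.+1 by have := ltn_ord v; lia.
  by rewrite modnn LnE.
have qE i j : L i = L j -> q i = q j by rewrite /q /quant -/(L i) => ->.
have stepL (v : 'I_n.+1) : `|L (ordS v) - L v| <= 1 by rewrite LS; apply: level_step.
have [r [rK rL rLS]] := crossing_pairing (@ordS_inj n.+1) stepL.
have JL (v : 'I_n.+1) : J v = (L (ordS v) != L v) by rewrite LS -LE.
have rJ (v : 'I_n.+1) : J (r v) = J v by rewrite !JL rLS rL eq_sym.
(* The distance to the next jump on the cycle cut at vertex 0; [find] returns [m] when there is none
   closer. By [sep] the first [m - 1] indices carry no jump, so no strip wraps around vertex 0. *)
pose d i := find (fun j => (i + j < n.+1)%N && J (i + j)%N) (iota 0 m).
have d_hit i : (d i < m)%N -> (i + d i < n.+1)%N /\ J (i + d i)%N.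
  move=> dm; have : has (fun j => (i + j < n.+1)%N && J (i + j)%N) (iota 0 m).
    by rewrite has_find size_iota.
  by move=> /(nth_find 0%N); rewrite -/(d i) nth_iota // add0n => /andP.
have d_strip t j : J t -> (t < n.+1)%N -> (j < m)%N -> d (t - j)%N = j.
  move=> Jt tn jm; have [jt _ _] := sep _ _ Jt jm.
  have dj : (d (t - j) <= j)%N.
    rewrite leqNgt; apply/negP => /(before_find 0%N).
    by rewrite nth_iota // add0n subnK // tn Jt.
  apply/eqP; rewrite eqn_leq dj leqNgt; apply/negP => lt_dj.
  have [_ ] := d_hit _ (leq_ltn_trans dj jm).
  have -> : (t - j + d (t - j) = t - (j - d (t - j)))%N by lia.
  have [_ _ h] := sep t (j - d (t - j)%N)%N Jt ltac:(lia).
  by apply/negP/h; lia.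
(* The jump that ends the strip of [v]; meaningful only when [d v < m]. *)
pose e (v : 'I_n.+1) : 'I_n.+1 := inord (v + d v).
have eE (v : 'I_n.+1) : (d v < m)%N -> val (e v) = (v + d v)%N.
  by move=> /d_hit [h _]; rewrite /= inordK.
have eJ (v : 'I_n.+1) : (d v < m)%N -> J (e v).
  by move=> dm; rewrite eE //; have [] := d_hit _ dm.
pose tau (v : 'I_n.+1) : 'I_n.+1 := if (d v < m)%N then inord (r (e v) - d v) else v.
have tauE (v : 'I_n.+1) : (d v < m)%N -> val (tau v) = (r (e v) - d v)%N.
  move=> dm; rewrite /tau dm /= inordK // (leq_ltn_trans (leq_subr _ _)) //.
have tau_out (v : 'I_n.+1) : (m <= d v)%N -> tau v = v by rewrite /tau ltnNge => ->.
have tau_d (v : 'I_n.+1) : d (tau v) = d v.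
  have [dm|dm] := ltnP (d v) m; last by rewrite tau_out.
  by rewrite tauE // d_strip ?rJ ?eJ.
have tau_e (v : 'I_n.+1) : (d v < m)%N -> e (tau v) = r (e v).
  move=> dm; apply: val_inj; rewrite eE ?tau_d // tauE // subnK //.
  by have [] := sep (r (e v)) (d v) ltac:(by rewrite -/J rJ eJ) dm.
have Le (v : 'I_n.+1) : (d v < m)%N -> L (e v) = L v.
  move=> dm; have [_ + _] := sep (e v) (d v) (eJ _ dm) dm.
  by rewrite -/L eE // addnK.
have Ltau (v : 'I_n.+1) : (d v < m)%N -> L (tau v) = L (e v).+1.
  by move=> dm; rewrite -Le ?tau_d // tau_e // rL LS.
(* After a jump or off the strips, the next vertex can at most begin a strip: if it were closer to a
   jump, then [v] would lie inside that strip or, when the next vertex is 0, [sep] would fail. *)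
have d_ordS (v : 'I_n.+1) : ((d v == 0) || (m <= d v))%N -> (m.-1 <= d (ordS v))%N.
  move=> dv; rewrite leqNgt; apply/negP => dS.
  have [h1 h2] := d_hit (ordS v) ltac:(lia).
  move: dS h1 h2; rewrite /=; have [vn|vn] := ltnP v.+1 n.+1; last first.
    have -> : v.+1 = n.+1 by have := ltn_ord v; lia.
    rewrite modnn add0n => dS h1 h2.
    have [h3 _ _] := sep (d 0%N) m.-1 h2 ltac:(lia).
    by move: dS; rewrite ltnNge h3.
  rewrite modn_small // => dS h1 h2.
  have tE : (v.+1 + d v.+1 - (d v.+1).+1 = v)%N by lia.
  have := d_strip _ (d v.+1).+1 h2 h1 ltac:(lia); rewrite tE => dvE.
  by move: dv; rewrite dvE; lia.
exists tau, (fun v => q v), (fun v => d v); split.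
- move=> v; have [dm|dm] := ltnP (d v) m; last by rewrite !tau_out.
  apply: val_inj; rewrite tauE ?tau_d // tau_e // rK eE //; exact: addnK.
- exact: tau_d.
- move=> lo hi h v; apply: (quant_bounds eta_gt0 m_gt0) => i; exact: h.
- by move=> v; rewrite -A_ord ltW //; apply: quant_near.
- move=> v; have [dm|dm] := ltnP (d v) m; last first.
    by rewrite tau_out // -A_ord ltW //; apply: quant_near.
  rewrite (qE _ _ (Ltau v dm)) -A_ord.
  have := quant_strip eta_gt0 m_gt0 lipA (eJ _ dm) dm.
  by rewrite -/q eE // addnK.
- move=> v; have [dm|dm] := ltnP (d v) m; last first.
    by rewrite tau_out // subrr normr0 mulr_ge0 // ltW.
  by rewrite (qE _ _ (Ltau v dm)) -(qE _ _ (Le v dm)); apply: quant_step.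
- move=> v dm; have := eJ v dm; rewrite JL LS -Ltau // Le //.
  have s0 : m.+1%:R * eta != 0 by rewrite mulf_neq0 ?pnatr_eq0 ?gt_eqF.
  by apply: contra => /eqP/addrI/(mulIf s0)/intr_inj /eqP.
- move=> v /andP[d0 dm]; have [h1 h2] := d_hit _ dm.
  have vn : (v.+1 < n.+1)%N by lia.
  have vS : val (ordS v) = v.+1 by rewrite /= modn_small.
  have dS : d (ordS v) = (d v).-1.
    have := d_strip _ (d v).-1 h2 h1 ltac:(lia); rewrite vS => <-.
    by congr d; lia.
  split=> //; have [h3 h4] := d_hit (tau v) ltac:(by rewrite tau_d).
  have tn : ((tau v).+1 < n.+1)%N by move: h3; rewrite tau_d; lia.
  have eS : e (ordS v) = e v.
    by apply: val_inj; rewrite !eE ?dS ?vS //; lia.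
  apply: val_inj; rewrite tauE ?dS; last by lia.
  rewrite eS /= modn_small // tauE //.
  have [+ _ _] := sep (r (e v)) (d v) ltac:(by rewrite -/J rJ eJ) dm.
  by lia.
- move=> v d0; apply: qE; rewrite LS; apply/eqP; rewrite -[_ == _]negbK LE -/J.
  apply/negP => Jv; have := d_strip v 0 Jv (ltn_ord v) m_gt0.
  by rewrite subn0 => dv; rewrite dv in d0.
- by move=> v dv; apply: d_ordS; rewrite dv orbT.
- move=> v dv; split; first by apply: d_ordS; rewrite dv.
  have dm : (d v < m)%N by rewrite dv.
  by apply: qE; rewrite LS Ltau // eE // dv addn0.
Qed.

End ExchangePattern.

(** * Sums of 2 x 2 blocks along an involution, and shift matrices *)

Section PairMatrices.
Variables (R : realType) (n : nat).
Local Notation C := R[i].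
Local Notation normc := Normc.normc.
Implicit Types (tau : 'I_n -> 'I_n) (al be : 'I_n -> C).

(** On a pair [i], [tau i] this is a 2 x 2 block with [al] on and [be] off the diagonal. At a fixed
    point of [tau] both terms add up in one diagonal entry. *)
Definition pairmx tau al be : 'M[C]_n :=
  \matrix_(i, j) (al i *+ (i == j) + be i *+ (tau i == j)).

Lemma mul_pairmxE tau al be (B : 'M[C]_n) i j :
  (pairmx tau al be *m B) i j = al i * B i j + be i * B (tau i) j.
Proof.
rewrite mxE; under eq_bigr do rewrite mxE mulrDl !mulrnAl.
rewrite big_split /=; congr (_ + _).
  by rewrite (bigD1 i) //= eqxx big1 ?addr0 // => k ki; rewrite eq_sym (negPf ki).
by rewrite (bigD1 (tau i)) //= eqxx big1 ?addr0 // => k ki; rewrite eq_sym (negPf ki).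
Qed.

Lemma eq_pairmx tau al be al' be' : al =1 al' -> be =1 be' ->
  pairmx tau al be = pairmx tau al' be'.
Proof. by move=> ea eb; apply/matrixP => i j; rewrite !mxE ea eb. Qed.

Lemma pairmx_diag tau al : pairmx tau al (fun=> 0) = diag_mx (\row_i al i).
Proof. by apply/matrixP => i j; rewrite !mxE mul0rn addr0. Qed.

Lemma pairmxB tau al be al' be' : pairmx tau al be - pairmx tau al' be' =
  pairmx tau (fun i => al i - al' i) (fun i => be i - be' i).
Proof. by apply/matrixP => i j; rewrite !mxE !mulrnBl; ring. Qed.

Section Involution.
Variable tau : 'I_n -> 'I_n.
Hypothesis tauK : involutive tau.

Lemma pairmxM al be al' be' : pairmx tau al be *m pairmx tau al' be' =
  pairmx tau (fun i => al i * al' i + be i * be' (tau i))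
             (fun i => al i * be' i + be i * al' (tau i)).
Proof.
apply/matrixP => i j; rewrite mul_pairmxE !mxE tauK.
by case: (i == j); case: (tau i == j); rewrite ?mulr1n ?mulr0n; ring.
Qed.

Lemma pairmx_adj al be : (pairmx tau al be)^t* =
  pairmx tau (fun i => (al i)^*%R) (fun i => (be (tau i))^*%R).
Proof.
apply/matrixP => i j; rewrite !mxE rmorphD !rmorphMn /= [j == i]eq_sym.
have [<-|ij] := eqVneq i j; first by have [->|] := eqVneq (tau i) i.
rewrite !mulr0n !add0r; have [<-|h] := eqVneq (tau i) j; first by rewrite tauK eqxx.
by have [e|] := eqVneq (tau j) i; rewrite ?mulr0n //; rewrite -e tauK eqxx in h.
Qed.

(** The matrix is a diagonal one plus a diagonal one times the permutation matrix of [tau], which is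
    an isometry. *)
Lemma pairmx_opnorm al be r1 r2 : 0 <= r1 -> 0 <= r2 ->
  (forall i, normc (al i) <= r1) -> (forall i, normc (be i) <= r2) ->
  opnorm (pairmx tau al be) <= r1 + r2.
Proof.
move=> r10 r20 h1 h2; pose P := pairmx tau (fun=> 0) (fun=> 1).
have -> : pairmx tau al be = diag_mx (\row_i al i) + diag_mx (\row_i be i) *m P.
  apply/matrixP => i j; rewrite -!(pairmx_diag tau) pairmxM !mxE.
  by rewrite !(mulr0, mul0r, addr0, add0r, mul0rn, mulr1).
rewrite (le_trans (opnormD _ _)) // lerD ?opnorm_diag_le //.
rewrite (le_trans (opnormM _ _)) // -[r2]mulr1 ler_pM ?opnorm_ge0 ?opnorm_diag_le //.
apply: opnorm_isometry_le; rewrite pairmx_adj pairmxM; apply/matrixP => i j.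
by rewrite !mxE conjC0 conjC1 !(mulr0, mul0r, addr0, add0r, mul0rn, mulr1).
Qed.

End Involution.

Lemma pairmx_real tau al be :
  (forall i, al i \is Num.real) -> (forall i, be i \is Num.real) ->
  pairmx tau al be \is a realmx.
Proof.
by move=> ha hb; apply/mxOverP => i j; rewrite mxE rpredD // rpredMn.
Qed.

Definition shiftmx (c : 'I_n -> C) : 'M[C]_n := \matrix_(i, j) (c j *+ (i == ordS j)).

Lemma weighted_shift_matrixE c S : weighted_shift_matrix c S -> S = shiftmx c.
Proof.
move=> h; apply/matrixP => i j; have := h j; rewrite /std_basis -colE.
by move=> /matrixP /(_ i 0); rewrite !mxE eqxx andbT mulr_natr.
Qed.

Lemma mul_shiftmxE c (B : 'M[C]_n) v j :
  (shiftmx c *m B) (ordS v) j = c v * B v j.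
Proof.
rewrite mxE (bigD1 v) //= mxE eqxx big1 ?addr0 // => k kv.
by rewrite mxE (inj_eq (@ordS_inj n)) eq_sym (negPf kv) mul0r.
Qed.

Lemma shiftmx_eq (A B : 'M[C]_n) :
  (forall v j, A (ordS v) j = B (ordS v) j) -> A = B.
Proof.
move=> h; apply/matrixP => i j.
by have [g _ gK] := injF_bij (@ordS_inj n); rewrite -(gK i) h.
Qed.

Lemma shiftmx_mul_diag c (d : 'I_n -> C) :
  shiftmx c *m diag_mx (\row_i d i) = shiftmx (fun i => c i * d i).
Proof. by apply/matrixP => i j; rewrite mul_mx_diag !mxE mulrnAl. Qed.

Lemma shiftmx_adj_mul c c' : (shiftmx c)^t* *m shiftmx c' =
  diag_mx (\row_i ((c i)^*%R * c' i)).
Proof.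
apply/matrixP => i j; rewrite !mxE (bigD1 (ordS i)) //= !mxE eqxx big1 ?addr0; last first.
  by move=> k ki; rewrite !mxE (negPf ki) conjC0 mul0r.
by rewrite (inj_eq (@ordS_inj n)); case: eqP => [->|_]; rewrite ?mulr0.
Qed.

Lemma shiftmx_unitary c : (forall v, normc (c v) = 1) ->
  (shiftmx c)^t* *m shiftmx c = 1%:M /\ shiftmx c *m (shiftmx c)^t* = 1%:M.
Proof.
move=> c1; suff h : (shiftmx c)^t* *m shiftmx c = 1%:M by split=> //; apply: mulmx1C.
rewrite shiftmx_adj_mul; apply/matrixP => i j; rewrite !mxE.
by rewrite mulrC -normCK -normc_normr c1 expr1n.
Qed.

Lemma shiftmx_real c : (forall v, c v \is Num.real) -> shiftmx c \is a realmx.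
Proof. by move=> h; apply/mxOverP => i j; rewrite mxE rpredMn. Qed.

End PairMatrices.

(** * A Lipschitz path on the unit circle *)

Section RationalCircle.
Variable R : realType.

(* Rational parametrisation of a quarter of the unit circle, from (1,0) at
   [t = 0] to (0,1) at [t = 1]; it is 2-Lipschitz in each coordinate. *)
Definition ccos (t : R) := (1 - t ^+ 2) / (1 + t ^+ 2).
Definition csin (t : R) := t *+ 2 / (1 + t ^+ 2).

Let den_gt0 (t : R) : 0 < 1 + t ^+ 2.
Proof. by rewrite ltr_wpDr ?sqr_ge0 ?ltr01. Qed.

Lemma ccos_csin t : ccos t ^+ 2 + csin t ^+ 2 = 1.
Proof. by rewrite /ccos /csin; field; rewrite gt_eqF. Qed.

Lemma ccos0 : ccos 0 = 1. Proof. by rewrite /ccos expr0n subr0 addr0 divr1. Qed.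
Lemma csin0 : csin 0 = 0. Proof. by rewrite /csin mul0rn mul0r. Qed.
Lemma ccos1 : ccos 1 = 0. Proof. by rewrite /ccos expr1n subrr mul0r. Qed.
Lemma csin1 : csin 1 = 1.
Proof. by rewrite /csin expr1n -[1 *+ 2]/(1 + 1) divff // gt_eqF // addr_gt0. Qed.

Lemma ccos_lip t u : 0 <= t <= 1 -> 0 <= u <= 1 ->
  `|ccos t - ccos u| <= 2 * `|t - u|.
Proof.
move=> /andP[t0 t1] /andP[u0 u1].
have -> : ccos t - ccos u =
    2 * (t - u) * (- (t + u) / ((1 + t ^+ 2) * (1 + u ^+ 2))).
  by rewrite /ccos; field; rewrite !gt_eqF.
rewrite normrM normrM ger0_norm // ler_piMr ?mulr_ge0 //.
rewrite mulNr normrN ger0_norm ?divr_ge0 ?addr_ge0 ?mulr_ge0 ?(ltW (den_gt0 _)) //.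
by rewrite ler_pdivrMr ?mulr_gt0 // mul1r; nra.
Qed.

Lemma csin_lip t u : 0 <= t <= 1 -> 0 <= u <= 1 ->
  `|csin t - csin u| <= 2 * `|t - u|.
Proof.
move=> /andP[t0 t1] /andP[u0 u1].
have -> : csin t - csin u =
    2 * (t - u) * ((1 - t * u) / ((1 + t ^+ 2) * (1 + u ^+ 2))).
  by rewrite /csin; field; rewrite !gt_eqF.
rewrite normrM normrM ger0_norm // ler_piMr ?mulr_ge0 //.
have tu : 0 <= 1 - t * u by rewrite subr_ge0 mulr_ile1.
rewrite ger0_norm ?(divr_ge0 tu) ?mulr_ge0 ?(ltW (den_gt0 _)) //.
by rewrite ler_pdivrMr ?mulr_gt0 // mul1r; nra.
Qed.

End RationalCircle.

(** * Turning reflections and the normal matrix built from them *)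

Section Exchange.
Variables (R : realType) (n : nat).
Local Notation C := R[i].
Local Notation normc := Normc.normc.


Section Reflections.
Variables (tau : 'I_n -> 'I_n) (eps : 'I_n -> R) (kap : 'I_n -> C).
Hypotheses (tauK : involutive tau) (eps1 : forall v, eps v ^+ 2 = 1).
Hypotheses (kap1 : forall v, normc (kap v) = 1).
Hypothesis (kap_tau : forall v, kap (tau v) = (kap v)^*%R).

(** When [eps] takes opposite signs on a pair, the block is a Hermitian reflection:
    [diag(eps, - eps)] at [t = 0], the swap with phase [kap] at [t = 1]. *)
Definition reflmx (t : 'I_n -> R) :=
  pairmx tau (fun v => (eps v * ccos (t v))%:C)
             (fun v => (csin (t v))%:C * kap v).

(** Where [t] vanishes the block is diagonal and any signs do. This must include the fixed points of
    [tau], where a sign cannot be its own opposite. *)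
Definition compatible (t : 'I_n -> R) := forall v,
  t (tau v) = t v /\ (t v != 0 -> eps (tau v) = - eps v).

Let kapK v : kap v * kap (tau v) = 1.
Proof. by rewrite kap_tau -normCK -normc_normr kap1 expr1n. Qed.

Let conjR (x : R) : (x%:C)^*%R = x%:C.
Proof. by rewrite conj_Creal //; apply/complex_realP; exists x. Qed.

Lemma reflmx_adj t : compatible t -> (reflmx t)^t* = reflmx t.
Proof.
move=> ct; rewrite pairmx_adj //; apply: eq_pairmx => v; first exact: conjR.
by rewrite rmorphM /= conjR kap_tau conjCK; have [-> _] := ct v.
Qed.

Lemma reflmx_conj t (b : 'I_n -> R) : compatible t ->
  reflmx t *m diag_mx (\row_v (b v)%:C) *m reflmx t =
  pairmx tau
    (fun v => (ccos (t v) ^+ 2 * b v + csin (t v) ^+ 2 * b (tau v))%:C)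
    (fun v => (eps v * ccos (t v) * csin (t v) * (b v - b (tau v)))%:C * kap v).
Proof.
move=> ct; rewrite -(pairmx_diag tau) !pairmxM //.
apply: eq_pairmx => v; have [tE eE] := ct v; rewrite !tE !mulr0 !add0r !addr0.
  rewrite [LHS](_ : _ = ((eps v * ccos (t v)) ^+ 2 * b v)%:C
     + (csin (t v) ^+ 2 * b (tau v))%:C * (kap v * kap (tau v))); last first.
    by rewrite !expr2 !rmorphM /=; ring.
  by rewrite kapK mulr1 exprMn eps1 mul1r -rmorphD.
have [t0|/eE ->] := eqVneq (t v) 0.
  by rewrite t0 csin0 !(mulr0, mul0r) addr0.
by rewrite !(rmorphM, rmorphB, rmorphN) /=; ring.
Qed.

(** The case [b = 1] of [reflmx_conj]. *)
Lemma reflmxK t : compatible t -> reflmx t *m reflmx t = 1%:M.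
Proof.
move=> ct; have := reflmx_conj (fun=> 1) ct.
have -> : diag_mx (\row__ 1%:C) = 1%:M :> 'M[C]_n.
  by apply/matrixP => i j; rewrite !mxE.
rewrite mulmx1 => ->; apply/matrixP => i j.
by rewrite !mxE !mulr1 ccos_csin subrr mulr0 mul0r mul0rn addr0.
Qed.

Lemma reflmx_opnorm t : compatible t -> opnorm (reflmx t) <= 1.
Proof. by move=> ct; apply: opnorm_isometry_le; rewrite reflmx_adj ?reflmxK. Qed.

Lemma reflmxB_opnorm t u r :
  (forall v, 0 <= t v <= 1) -> (forall v, 0 <= u v <= 1) ->
  (forall v, `|t v - u v| <= r) -> 0 <= r ->
  opnorm (reflmx t - reflmx u) <= 4 * r.
Proof.
move=> ht hu tu r0; rewrite pairmxB.
have -> : 4 * r = 2 * r + 2 * r by ring.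
have eps_norm v : `|eps v| = 1.
  by apply/eqP; rewrite -(@eqrXn2 _ 2) // real_normK ?num_real // eps1 expr1n.
apply: pairmx_opnorm => //; rewrite ?mulr_ge0 // => v.
  rewrite -rmorphB normc_real -mulrBr normrM eps_norm mul1r.
  by rewrite (le_trans (ccos_lip _ _)) // ler_wpM2l.
rewrite -mulrBl -rmorphB Normc.normcM kap1 mulr1 normc_real.
by rewrite (le_trans (csin_lip _ _)) // ler_wpM2l.
Qed.

End Reflections.


(* [N = (P W' W) (W B W)] is a polar decomposition, and [N] is normal because
   the unitary factor commutes with [W B^2 W]. *)
Lemma conj_shift_normal (P W W' B : 'M[C]_n) :
  P^t* *m P = 1%:M -> P *m P^t* = 1%:M -> W *m W = 1%:M -> W' *m W' = 1%:M ->
  W^t* = W -> W'^t* = W' -> B^t* = B ->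
  P *m (W' *m (B *m B) *m W') = W *m (B *m B) *m W *m P ->
  P *m W' *m B *m W \is normalmx.
Proof.
move=> PP PP' WW WW' Wadj Wadj' Badj key; apply/normalmxP.
rewrite !trmx_mul !map_mxM /= Wadj Wadj' Badj.
transitivity (P *m (W' *m (B *m (W *m W) *m B) *m W') *m P^t*).
  by rewrite !mulmxA.
rewrite WW mulmx1 key -mulmxA PP' mulmx1.
transitivity (W *m B *m (W' *m (P^t* *m P) *m W') *m B *m W).
  by rewrite PP mulmx1 WW' mulmx1 !mulmxA.
by rewrite !mulmxA.
Qed.

(* The unimodular [kap] transports the relative phase of two paired strips, so
   that the phases [om] of the shift do not disturb the exchange. *)
Lemma exchange_normal (om : 'I_n -> C) (a : 'I_n -> R) m s M tau b d :
  (0 < m)%N -> (forall v, normc (om v) = 1) ->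
  (forall v, 0 <= a v <= M) -> 0 <= M -> 0 <= s ->
  exchange_pattern a m s tau b d ->
  exists N : 'M[C]_n,
    [/\ N \is normalmx, opnorm N <= M,
        (forall v, om v \is Num.real) -> N \is a realmx
      & opnorm (N - shiftmx (fun v => om v * (a v)%:C))
          <= 4 * m%:R^-1 * M + 3 / 2 * s].
Proof.
move=> m0 om1 aM M0 s0 [tauK dtau bnd near near_tau gap neq inner const outer ends].
(* [gam] accumulates the phases of the shift from vertex 0, and [kap] compares them at the two
   vertices of a pair. *)
pose gam (i : nat) : C := \prod_(j < n | (j < i)%N) om j.
pose kap (v : 'I_n) := gam v * (gam (tau v))^*%R.
have gamS (v : 'I_n) : gam v.+1 = gam v * om v.
  rewrite /gam (bigD1 v) //= mulrC; congr (_ * _); apply: eq_bigl => j.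
  by rewrite ltnS [(j < v)%N]ltn_neqAle andbC.
have gam1 i : normc (gam i) = 1.
  rewrite /gam; elim/big_rec: _ => [|j x _ IH]; first exact: Normc.normc1.
  by rewrite Normc.normcM om1 IH mulr1.
have normcJ (z : C) : normc z^*%R = normc z.
  by apply: complexI; rewrite !normc_normr norm_conjC.
have kap1 v : normc (kap v) = 1 by rewrite Normc.normcM normcJ !gam1 mulr1.
have kap_tau v : kap (tau v) = (kap v)^*%R.
  by rewrite /kap tauK rmorphM /= conjCK mulrC.
(* Reading the sign off the order of the two weights makes it constant along a strip and opposite on
   the partner strip, [neq] excluding ties. *)
pose eps v : R := if b v <= b (tau v) then 1 else -1.
have eps1 v : eps v ^+ 2 = 1 by rewrite /eps; case: ifP; rewrite ?sqrrN expr1n.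
have eps_tau v : (d v < m)%N -> eps (tau v) = - eps v.
  move=> /neq; rewrite /eps tauK neq_lt.
  by case/orP => h; rewrite (ltW h) leNgt h /= ?opprK.
(* Along a strip [t] runs from 0 to [(m - 1) / m] and [t'] from [1 / m] to 1, with
   [t' v = t (ordS v)] before the jump; truncated subtraction makes both 0 off the strips. At the
   jump [t'] completes the swap, and [t] restarts from 0. *)
pose t v : R := (m.-1 - d v)%N%:R / m%:R.
pose t' v : R := (m - d v)%N%:R / m%:R.
have mR0 : 0 < m%:R :> R by rewrite ltr0n.
have t01 v : 0 <= t v <= 1.
  by rewrite divr_ge0 ?ler0n //= ler_pdivrMr // mul1r ler_nat; lia.
have t'01 v : 0 <= t' v <= 1.
  by rewrite divr_ge0 ?ler0n //= ler_pdivrMr // mul1r ler_nat; lia.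
have tt' v : `|t' v - t v| <= m%:R^-1.
  rewrite -mulrBl normrM [`|_^-1|]ger0_norm ?invr_ge0 ?ler0n //.
  rewrite ler_piMl ?invr_ge0 ?ler0n // -natrB ?normr_nat; last by lia.
  by rewrite (ler_nat _ _ 1); lia.
have ct : compatible tau eps t.
  move=> v; rewrite /t dtau; split=> // h; apply: eps_tau.
  by rewrite ltnNge; apply: contra h => h; rewrite (_ : m.-1 - d v = 0)%N ?mul0r //; lia.
have ct' : compatible tau eps t'.
  move=> v; rewrite /t' dtau; split=> // h; apply: eps_tau.
  by rewrite ltnNge; apply: contra h => h; rewrite (_ : m - d v = 0)%N ?mul0r //; lia.
have t_out v : (m.-1 <= d v)%N -> t v = 0.
  by move=> h; rewrite /t (_ : m.-1 - d v = 0)%N ?mul0r //; lia.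
have t'_out v : (m <= d v)%N -> t' v = 0.
  by move=> h; rewrite /t' (_ : m - d v = 0)%N ?mul0r //; lia.
have t'_end v : d v = 0%N -> t' v = 1.
  by move=> h; rewrite /t' h subn0 divff // gt_eqF.
have t_ordS v : (0 < d v < m)%N -> t (ordS v) = t' v.
  by move=> h; rewrite /t /t'; have [_ -> _] := inner v h; congr (_%:R * _); lia.
pose W := reflmx tau eps kap t; pose W' := reflmx tau eps kap t'.
pose P := shiftmx om; pose B := diag_mx (\row_v (b v)%:C) : 'M[C]_n.
have [PP PP'] := shiftmx_unitary om1.
have WW : W *m W = 1%:M by apply: reflmxK.
have WW' : W' *m W' = 1%:M by apply: reflmxK.
have Wadj : W^t* = W by apply: reflmx_adj.
have Wadj' : W'^t* = W' by apply: reflmx_adj.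
have Badj : B^t* = B.
  rewrite tr_diag_mx map_diag_mx /=; congr diag_mx; apply/rowP => i; rewrite !mxE.
  by rewrite conj_Creal //; apply/complex_realP; exists (b i).
have BB : B *m B = diag_mx (\row_v (b v ^+ 2)%:C).
  rewrite mulmx_diag; congr diag_mx; apply/rowP => i.
  by rewrite !mxE -rmorphM expr2.
(* The conjugated weights [W B^2 W] are carried by the shift to [W' B^2 W']. *)
have key : P *m (W' *m (B *m B) *m W') = W *m (B *m B) *m W *m P.
  rewrite BB !(reflmx_conj tauK) //; apply: shiftmx_eq => v j.
  rewrite mul_shiftmxE mul_pairmxE !mxE (inj_eq (@ordS_inj n)).
  (* Three cases. At a jump [W'] swaps the weights, giving [b (tau v)], which is the value after the
     jump. Off the strips nothing is turned and [b] is constant. Inside a strip the parameters agree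
     by [t_ordS]. *)
  have [d0|dpos] := posnP (d v).
    have [h1 h2] := ends v d0.
    rewrite (t_out _ h1) (t'_end _ d0) ccos0 csin0 ccos1 csin1 h2.
    rewrite !(expr0n, expr1n) /= !(mul0r, mulr0, mul1r, mulr1, addr0, add0r).
    by rewrite ?(mul0r, mul0rn, addr0); case: eqP => [->|_]; rewrite ?mulr0 // mulrC.
  have [dm|dm] := leqP m (d v).
    rewrite (t_out _ (outer _ dm)) (t'_out _ dm) ccos0 csin0 (const _ dpos).
    rewrite !(expr0n, expr1n) /= !(mul0r, mulr0, mul1r, mulr1, addr0, add0r).
    by rewrite ?(mul0r, mul0rn, addr0); case: eqP => [->|_]; rewrite ?mulr0 // mulrC.
  have dv : (0 < d v < m)%N by rewrite dpos.
  have dtv : (0 < d (tau v) < m)%N by rewrite dtau.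
  have [vn _ tS] := inner v dv; have [tvn _ _] := inner _ dtv.
  have bS := const _ dpos; have btS : b (ordS (tau v)) = b (tau v) by apply: const; rewrite dtau.
  have eS : eps (ordS v) = eps v by rewrite /eps tS bS btS.
  have vSE : nat_of_ord (ordS v) = v.+1 by rewrite /= modn_small.
  have tvSE : nat_of_ord (ordS (tau v)) = (tau v).+1 by rewrite /= modn_small.
  (* From [v] to its successor [kap] gains the phase [om v] and the conjugate of [om (tau v)]. *)
  have kS : kap (ordS v) * om (tau v) = kap v * om v.
    rewrite /kap tS vSE tvSE !gamS rmorphM /=.
    transitivity (gam v * om v * (gam (tau v))^*%R * (om (tau v) * (om (tau v))^*%R)); first by ring.
    by rewrite -normCK -normc_normr om1 expr1n mulr1 mulrAC.
  rewrite eS tS bS btS t_ordS // (inj_eq (@ordS_inj n)).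
  rewrite mulrDr; congr (_ + _).
    by case: eqP => [->|_]; rewrite ?mulr0n ?mulr0 // !mulr1n mulrC.
  case: eqP => [<-|_]; rewrite ?mulr0n ?mulr0 // !mulr1n.
  by rewrite -[RHS]mulrA kS mulrCA [om v * _]mulrC.
pose N := P *m W' *m B *m W.
have bM v : 0 <= b v <= M by apply: bnd.
have PX (X : 'M[C]_n) : opnorm (P *m X) <= opnorm X.
  rewrite (le_trans (opnormM _ _)) // ler_piMl ?opnorm_ge0 //.
  exact: (opnorm_isometry_le PP).
have BW : opnorm (B *m W) <= M.
  have W1 : opnorm W <= 1 by apply: reflmx_opnorm.
  rewrite (le_trans (opnormM _ _)) // -[M]mulr1; apply: (ler_pM (opnorm_ge0 _) (opnorm_ge0 _) _ W1).
  apply: opnorm_diag_le => // v; rewrite normc_real.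
  by have /andP[? ?] := bM v; rewrite ger0_norm.
exists N; split.
- exact: (conj_shift_normal PP PP' WW WW' Wadj Wadj' Badj key).
- have -> : N = P *m (W' *m (B *m W)) by rewrite !mulmxA.
  apply: (le_trans (PX _)); apply: (le_trans (opnormM _ _)).
  have W'1 : opnorm W' <= 1 by apply: reflmx_opnorm.
  rewrite -[M]mul1r; exact: (ler_pM (opnorm_ge0 _) (opnorm_ge0 _) W'1 BW).
- move=> om_real.
  have gam_real i : gam i \is Num.real by apply: rpred_prod => j _; apply: om_real.
  have Creal (x : R) : x%:C \is Num.real by apply/complex_realP; exists x.
  have W_real u : reflmx tau eps kap u \is a realmx.
    by apply: pairmx_real => v //; rewrite !rpredM ?conj_Creal.
  have mul_real (X Y : 'M[C]_n) : X \is a realmx -> Y \is a realmx -> X *m Y \is a realmx.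
    move=> /mxOverP hX /mxOverP hY; apply/mxOverP => i j; rewrite mxE.
    by apply: rpred_sum => k _; rewrite rpredM.
  have B_real : B \is a realmx by apply/mxOverP => i j; rewrite !mxE rpredMn.
  apply: (mul_real _ _ _ (W_real t)); apply: (mul_real _ _ _ B_real).
  by apply: (mul_real _ _ _ (W_real t')); apply: shiftmx_real.
- pose Da := diag_mx (\row_v (a v)%:C) : 'M[C]_n.
  rewrite -shiftmx_mul_diag -/P -/Da.
  (* The first term is the cost of turning, at most [4 M / m]; the second is the cost of changing
     the weights. *)
  have -> : N - P *m Da = P *m ((W' - W) *m (B *m W) + (W *m B *m W - Da)).
    by rewrite /N mulmxBl !mulmxA addrA subrK mulmxBr !mulmxA.
  apply: (le_trans (PX _)); apply: (le_trans (opnormD _ _)); apply: lerD.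
    apply: (le_trans (opnormM _ _)); apply: (ler_pM (opnorm_ge0 _) (opnorm_ge0 _) _ BW).
    by apply: reflmxB_opnorm => //; rewrite invr_ge0 ler0n.
  rewrite (reflmx_conj tauK) // -[Da](pairmx_diag tau) pairmxB.
  (* Diagonal entries of [W B W] are convex combinations of [b v] and [b (tau v)], hence within [s]
     of [a v]. Off-diagonal ones are at most [s / 2], as the product of cosine and sine is at most
     1/2. *)
  have -> : 3 / 2 * s = s + s / 2 by field.
  have cs v := ccos_csin (t v).
  apply: pairmx_opnorm => //; rewrite ?divr_ge0 // => v.
    rewrite -rmorphB normc_real.
    have x0 := sqr_ge0 (ccos (t v)); have y0 := sqr_ge0 (csin (t v)).
    have xy := cs v; move: (ccos (t v) ^+ 2) (csin (t v) ^+ 2) x0 y0 xy => x y x0 y0 xy.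
    have -> : x * b v + y * b (tau v) - a v =
        - (x * (a v - b v) + y * (a v - b (tau v))).
      by rewrite -[in LHS](mul1r (a v)) -xy; ring.
    rewrite normrN (le_trans (ler_normD _ _)) // !normrM !(@ger0_norm _ x, @ger0_norm _ y) //.
    have := ler_wpM2l x0 (near v); have := ler_wpM2l y0 (near_tau v).
    by rewrite -[in X in _ -> _ -> X](mul1r s) -xy mulrDl; lra.
  rewrite subr0 Normc.normcM kap1 mulr1 normc_real -(mulrA (eps v)) normrM normrM.
  have -> : `|eps v| = 1 by rewrite /eps; case: ifP; rewrite ?normrN normr1.
  rewrite mul1r distrC [s / 2]mulrC; apply: ler_pM => //.
  rewrite ler_norml; have := cs v.
  have := sqr_ge0 (ccos (t v) - csin (t v)); have := sqr_ge0 (ccos (t v) + csin (t v)).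
  by set x := ccos _; set y := csin _; nra.
Qed.

End Exchange.

(** * Normal matrices as sums of shifts; shifts with slowly varying weights *)

Section Approximation.
Variable R : realType.
Local Notation C := R[i].
Local Notation normc := Normc.normc.

(* By the spectral theorem a normal matrix is a direct sum of 1 x 1 blocks, and
   every 1 x 1 matrix is a weighted shift operator. *)
Lemma normal_sum_of_shifts n (N : 'M[C]_n) :
  N \is normalmx -> equiv_sum_of_weighted_shifts N.
Proof.
move=> /orthomx_spectralP; have := spectral_unitarymx N.
move: (spectralmx N) (spectral_diag N) => V D VU; rewrite invmx_unitary // => NE.
pose B (j : 'I_n) : 'M[C]_1 := (D 0 j)%:M.
exists n, (fun=> 1%N), B; split=> // [j|].
  exists (fun=> 1%:M), (fun=> D 0 j); split=> [i k|i].
    by rewrite !ord1 trmx1 map_mx1 mulmx1.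
  by rewrite /B mul_scalar_mx.
(* This is [V] cut into rows, so that its type matches the block diagonal matrix. *)
pose U := \mxcol_(j < n) row j V.
have Uadj : U^t* = \mxrow_(j < n) (row j V)^t*.
  by apply/matrixP => i j; rewrite !mxE.
have VV : V *m V^t* = 1%:M by apply/unitarymxP.
have VV' : V^t* *m V = 1%:M by apply: mulmx1C.
have sumE (X : 'I_n -> C) :
    \sum_j (row j V)^t* *m ((X j)%:M *m row j V) = V^t* *m diag_mx (\row_j X j) *m V.
  apply/matrixP => i k; rewrite -mulmxA mxE summxE; apply: eq_bigr => j _.
  by rewrite mul_scalar_mx mul_diag_mx !mxE big_ord_recl big_ord0 !mxE addr0.
exists U; split.
- apply/unitarymxP; rewrite Uadj mul_mxcol_mxrow -(mxdiagZ (p_ := fun=> 1%N)) /mxdiag.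
  apply/eq_mxblockP => i j; apply/matrixP => k l; rewrite !ord1 !mxE.
  have := congr1 (fun X : 'M_n => X i j) VV; rewrite !mxE => VVij.
  transitivity ((i == j)%:R : C).
    by rewrite -VVij; apply: eq_bigr => u _; rewrite !mxE.
  by case: eqP => _; rewrite ?conform_mx_id mxE.
- apply/unitarymxP; rewrite trmxCK Uadj mul_mxrow_mxcol.
  have := sumE (fun=> 1); under eq_bigr do rewrite mul1mx.
  move=> ->; rewrite (_ : diag_mx _ = 1%:M) ?mulmx1 //.
  by apply/matrixP => i j; rewrite !mxE.
- rewrite -mulmxA mul_mxdiag_mxcol Uadj mul_mxrow_mxcol sumE NE.
  have -> : \row_j D 0 j = D by apply/rowP => j; rewrite mxE.
  by [].
Qed.

Lemma normalmx0 n : (0 : 'M[C]_n) \is normalmx.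
Proof. by apply/normalmxP; rewrite !mul0mx mulmx0. Qed.

Lemma realmx0 n : (0 : 'M[C]_n) \is a realmx.
Proof. by apply: mxOver0; exact: rpred0. Qed.

Lemma opnorm_shiftmx_le n (c : 'I_n -> C) r : 0 <= r ->
  (forall v, normc (c v) <= r) -> opnorm (shiftmx c) <= r.
Proof.
move=> r0 cr; pose one : 'I_n -> C := fun=> 1.
have [PP _] := shiftmx_unitary (c := one) (fun=> Normc.normc1 _).
have -> : shiftmx c = shiftmx one *m diag_mx (\row_v c v).
  by rewrite shiftmx_mul_diag; apply/matrixP => i j; rewrite !mxE mul1r.
rewrite (le_trans (opnormM _ _)) // -[r]mul1r.
apply: ler_pM; rewrite ?opnorm_ge0 ?opnorm_diag_le //; exact: opnorm_isometry_le.
Qed.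

Lemma shift_approx n (om : 'I_n -> C) (a : 'I_n -> R) (M eta : R) :
  (0 < n)%N -> 0 < eta -> (forall v, normc (om v) = 1) ->
  (forall v, 0 <= a v <= M) -> (forall v, `|a (ordS v) - a v| <= eta) ->
  exists N : 'M[C]_n,
    [/\ N \is normalmx, opnorm N <= M,
        (forall v, om v \is Num.real) -> N \is a realmx
      & opnorm (N - shiftmx (fun v => om v * (a v)%:C)) <= 6 * Num.sqrt (M * eta)].
Proof.
move=> n0 eta0 om1 aM lip.
have M0 : 0 <= M by have /andP[h1 h2] := aM (Ordinal n0); exact: le_trans h1 h2.
pose r := Num.sqrt (M * eta).
have r0 : 0 <= r := sqrtr_ge0 _.
have r2 : r ^+ 2 = M * eta by rewrite sqr_sqrtr // mulr_ge0 // ltW.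
(* For [M <= 6 r] the zero matrix is close enough. Otherwise [sqrt (M / eta)], called [q] below,
   exceeds 6, so rounding [m] to an integer costs at most [3 eta <= r / 2]. *)
rewrite -/r; have [Mr|rM] := lerP M (6 * r).
  exists 0; split; rewrite ?normalmx0 ?opnorm0 ?realmx0 //.
  rewrite sub0r opnormN (le_trans _ Mr) //; apply: opnorm_shiftmx_le => // v.
  have /andP[av0 avM] := aM v.
  by rewrite Normc.normcM om1 mul1r normc_real ger0_norm.
have rpos : 0 < r.
  rewrite lt0r r0 andbT; apply/eqP => rE; move: rM r2.
  by rewrite rE mulr0 expr0n => Mpos /esym/eqP; rewrite mulf_eq0 !gt_eqF.
(* The error is at most [4 M / m + 3 / 2 (m + 1) eta] for strips of length [m];
   it is balanced by [m] close to [8 / 5 * sqrt (M / eta)]. *)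
pose q := r / eta.
have Mq : M = q * r by rewrite /q mulrAC -expr2 r2 mulfK ?gt_eqF.
have eq : eta * q = r by rewrite /q mulrC divfK ?gt_eqF.
have q6 : 6 < q by move: rM; rewrite Mq ltr_pM2r.
pose m := (Num.truncn (8 / 5 * q)).+1.
have q85 : 0 <= 8 / 5 * q by lra.
have /andP[m1 m2] := truncn_itv q85.
have [tau [b [d xp]]] := exchange_pattern_exists n0 eta0 (isT : (0 < m)%N) lip.
have s0 : 0 <= m.+1%:R * eta by rewrite mulr_ge0 ?ler0n // ltW.
have [N [N1 N2 N3 N4]] := exchange_normal (isT : (0 < m)%N) om1 aM M0 s0 xp.
exists N; split=> //; apply: le_trans N4 _.
have mpos : 0 < m%:R :> R by rewrite ltr0n.
have h1 : 4 * m%:R^-1 * M <= 5 / 2 * r.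
  rewrite mulrAC ler_pdivrMr // Mq.
  have : 8 / 5 * q * r <= m%:R * r by rewrite ler_pM2r // ltW.
  by lra.
have h2 : m.+1%:R * eta <= 8 / 5 * r + 2 * eta.
  rewrite /m -[_.+2]addn2 natrD mulrDl lerD2r -eq.
  by rewrite [eta * q]mulrC [leRHS]mulrA ler_pM2r.
have h3 : 6 * eta <= r by rewrite -eq mulrC ler_pM2l // ltW.
(* The total is [5/2 + 12/5 + 1/2 = 27/5] in units of [r]. *)
by lra.
Qed.

(** Factor [x^2 - y^2 = (x - y) (x + y)], the sum being at least [2 sigma] above the threshold. A
    value below [sigma] may be replaced by [sigma], which only shrinks the difference of squares. *)
Lemma max_sqr_lip (x y delta sigma : R) :
  0 <= x -> 0 <= y -> 0 < sigma -> `|x ^+ 2 - y ^+ 2| <= delta ->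
  `|Num.max x sigma - Num.max y sigma| <= delta / (2 * sigma).
Proof.
move=> x0 y0 s0 h; rewrite ler_pdivlMr ?mulr_gt0 //.
have d0 : 0 <= delta := le_trans (normr_ge0 _) h.
wlog xy : x y x0 y0 h / y <= x.
  move=> W; have [|/ltW] := lerP y x; first exact: W.
  by rewrite distrC; apply: W => //; rewrite distrC.
move: h; rewrite ger0_norm ?subr_ge0 ?lerXn2r ?nnegrE // => h.
rewrite ger0_norm ?subr_ge0; last by rewrite ge_max !le_max xy lexx orbT.
have [sy|ys] := lerP sigma y.
  rewrite !max_l //; [nra | exact: le_trans sy xy].
have [sx|xs] := lerP sigma x; last by rewrite subrr mul0r.
nra.
Qed.

End Approximation.

(** * The two estimates in terms of the commutator *)

Section WeightedShifts.
Variable R : realType.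
Local Notation C := R[i].
Local Notation normc := Normc.normc.

Lemma polar_weights n (c : 'I_n -> C) : exists om : 'I_n -> C,
  [/\ forall v, normc (om v) = 1, forall v, c v = om v * (normc (c v))%:C
    & forall v, c v \is Num.real -> om v \is Num.real].
Proof.
(* Zero weights get the phase 1, which is unimodular and real. *)
exists (fun v => if c v == 0 then 1 else c v / (normc (c v))%:C).
have nz v : c v != 0 -> normc (c v) != 0.
  by apply: contra => /eqP /Normc.eq0_normc ->.
split=> v; case: ifPn.
- by move=> _; exact: Normc.normc1.
- by move=> /nz cv; rewrite Normc.normcM Normc.normcV normc_real ger0_norm ?normc_ge0 // divff.
- by move=> /eqP ->; rewrite mul1r Normc.normc0.
- by move=> cv; rewrite divfK // normc_normr normr_eq0.
- by move=> _ _; exact: rpred1.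
- by move=> _ cv; rewrite rpredM // rpredV normc_normr normr_real.
Qed.

(** The difference is the diagonal entry of the commutator at [ordS v]. *)
Lemma shiftmx_commutator n (c : 'I_n -> C) v :
  `|normc (c (ordS v)) ^+ 2 - normc (c v) ^+ 2| <=
    opnorm (commutator ((shiftmx c)^t*) (shiftmx c)).
Proof.
apply: le_trans (normc_le_opnorm _ (ordS v) (ordS v)).
rewrite le_eqVlt; apply/orP; left; apply/eqP.
rewrite /commutator shiftmx_adj_mul -normc_real; congr normc.
rewrite [RHS]mxE [X in _ = _ + X]mxE mul_shiftmxE !mxE !eqxx !mulr1n.
by rewrite rmorphB !rmorphXn /= !normc_normr !normCK [_ * c _]mulrC.
Qed.

Lemma opnorm_commutator0_normal n (S : 'M[C]_n) :
  opnorm (commutator (S^t*) S) = 0 -> S \is normalmx.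
Proof.
by move/opnorm_eq0/eqP; rewrite subr_eq0 => /eqP h; apply/normalmxP.
Qed.

(** Raised to at least [sigma], the moduli have Lipschitz constant [delta / (2 sigma)]; since
    [sigma <= opnorm S] they stay below the norm of [S]. *)
Lemma shift_approx_truncated n (c om : 'I_n -> C) (sigma : R) :
  let S := shiftmx c in
  let delta := opnorm (commutator (S^t*) S) in
  (0 < n)%N -> 0 < delta -> 0 < sigma <= opnorm S ->
  (forall v, normc (om v) = 1) ->
  exists N : 'M[C]_n,
    [/\ N \is normalmx, opnorm N <= opnorm S,
        (forall v, om v \is Num.real) -> N \is a realmx
      & opnorm (N - shiftmx (fun v => om v * (Num.max (normc (c v)) sigma)%:C))
          <= 6 * Num.sqrt (opnorm S * (delta / (2 * sigma)))].
Proof.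
move=> S delta n0 d0 /andP[s0 sM] om1.
have cM v : normc (c v) <= opnorm S.
  by have := normc_le_opnorm S (ordS v) v; rewrite mxE eqxx mulr1n.
have comm v : `|normc (c (ordS v)) ^+ 2 - normc (c v) ^+ 2| <= delta.
  exact: shiftmx_commutator.
move: (opnorm S) delta d0 sM cM comm => M delta d0 sM cM comm.
apply: shift_approx => // [|v|v]; first by rewrite divr_gt0 ?mulr_gt0.
- by rewrite le_max normc_ge0 /= ge_max cM sM.
- by apply: max_sqr_lip; rewrite ?normc_ge0.
Qed.

Lemma realmx_shift n (c : 'I_n -> C) v : shiftmx c \is a realmx -> c v \is Num.real.
Proof. by move=> /mxOverP /(_ (ordS v) v); rewrite mxE eqxx mulr1n. Qed.

(** Let [y] be the cube root of the product of the two norms. Raising the moduli to [9/4 y] costs at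
    most [9/4 y], and the approximation then costs [6 sqrt (2/9) y <= 3 y]; together [21/4 y]. If
    the norm of [S] is below the threshold, 0 serves as [N]. *)
Lemma shift_normal_approx n (S : 'M[C]_n) (c : 'I_n -> C) : (0 < n)%N ->
  weighted_shift_matrix c S ->
  exists N : 'M[C]_n,
    [/\ N \is normalmx,
        opnorm (N - S) <= 21 / 4 * opnorm S `^ (1 - 2 * (1 / 3))
          * opnorm (commutator (S^t*) S) `^ (1 / 3),
        opnorm N <= opnorm S & S \is a realmx -> N \is a realmx].
Proof.
move=> n0 /weighted_shift_matrixE {S}->; set S := shiftmx c.
have [om [om1 omc om_real]] := polar_weights c.
have M0 := opnorm_ge0 S; have d0 := opnorm_ge0 (commutator (S^t*) S).
have normal0 := @opnorm_commutator0_normal n S.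
have := @shift_approx_truncated n c om _ n0; rewrite -/S /=.
move: M0 d0 normal0; move ME: (opnorm S) => M; move: (opnorm (commutator _ _)) => delta.
move=> M0 d0 normal0 approx.
(* The Lipschitz constant has to be positive; when the commutator vanishes, [S] itself is normal. *)
have [dE|dE] := eqVneq delta 0.
  exists S; split; [exact: normal0 | | by rewrite ME | by []].
  by rewrite subrr opnorm0 !mulr_ge0 ?powR_ge0 ?invr_ge0.
have {}d0 : 0 < delta by rewrite lt0r dE.
have -> : 1 - 2 * (1 / 3) = 3^-1 :> R by field.
rewrite div1r -mulrA -powRM ?(ltW d0) //; set y := _ `^ _.
have y3 : y ^+ 3 = M * delta.
  by rewrite -powR_mulrn ?powR_ge0 // -powRrM mulVf ?pnatr_eq0 // powRr1 // mulr_ge0 // ltW.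
have y0 : 0 <= y := powR_ge0 _ _.
have [My|yM] := lerP M (9 / 4 * y).
  exists 0; split; rewrite ?normalmx0 ?opnorm0 ?realmx0 //.
  by rewrite sub0r opnormN ME; lra.
have Mpos : 0 < M by lra.
have ypos : 0 < y.
  rewrite lt0r y0 andbT; apply/eqP => yE; move: y3; rewrite yE expr0n.
  by move/esym/eqP; rewrite mulf_eq0 !gt_eqF.
have s0 : 0 < 9 / 4 * y by lra.
have sM : 0 < 9 / 4 * y <= M by rewrite s0 ltW.
have [N [N1 N2 N3 N4]] := approx _ d0 sM om1.
exists N; split=> //; last first.
  by move=> Sreal; apply: N3 => v; apply/om_real/realmx_shift.
set T := shiftmx _ in N4.
have TS : opnorm (T - S) <= 9 / 4 * y.
  have -> : T - S = shiftmx (fun v =>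
      om v * (Num.max (normc (c v)) (9 / 4 * y) - normc (c v))%:C).
    apply/matrixP => i j; rewrite !mxE -mulrnBl; congr (_ *+ _).
    by rewrite {2}(omc j) rmorphB /= mulrBr.
  apply: opnorm_shiftmx_le => [|v]; first exact: ltW.
  rewrite Normc.normcM om1 mul1r normc_real ger0_norm ?subr_ge0 ?le_max ?lexx //.
  by rewrite lerBlDr ge_max lerDr lerDl normc_ge0 ltW.
have sq : Num.sqrt (M * (delta / (2 * (9 / 4 * y)))) <= y / 2.
  rewrite -[leRHS]ger0_norm ?divr_ge0 // -sqrtr_sqr ler_wsqrtr //.
  have -> : M * (delta / (2 * (9 / 4 * y))) = y ^+ 2 * (2 / 9).
    by rewrite mulrA -y3; field; exact: lt0r_neq0.
  by rewrite exprMn ler_wpM2l ?sqr_ge0 //; clear; lra.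
have -> : N - S = (N - T) + (T - S) by rewrite addrA subrK.
apply: le_trans (opnormD _ _) _; apply: le_trans (lerD N4 TS) _.
by move: (Num.sqrt _) sq => z sq {N1 N2 N3 N4 TS ME}; lra.
Qed.

Lemma shift_normal_approx_bounded_below n (S : 'M[C]_n) (c : 'I_n -> C) (sigma : R) :
  (0 < n)%N -> weighted_shift_matrix c S -> 0 < sigma ->
  (forall j, sigma <= normc (c j)) ->
  exists N : 'M[C]_n,
    [/\ N \is normalmx, opnorm N <= opnorm S, S \is a realmx -> N \is a realmx
      & opnorm (N - S) <=
          (485 / 10 ^+ 2 + 73 / 10 ^+ 4) * Num.sqrt (opnorm S / sigma)
            * opnorm (commutator (S^t*) S) `^ (1 / 2)].
Proof.
move=> n0 /weighted_shift_matrixE {S}-> s0 cs; set S := shiftmx c.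
have [om [om1 omc om_real]] := polar_weights c.
have sM : 0 < sigma <= opnorm S.
  rewrite s0 (le_trans (cs (Ordinal n0))) //.
  by have := normc_le_opnorm S (ordS (Ordinal n0)) (Ordinal n0); rewrite mxE eqxx mulr1n.
have M0 := opnorm_ge0 S; have d0 := opnorm_ge0 (commutator (S^t*) S).
have normal0 := @opnorm_commutator0_normal n S.
have := @shift_approx_truncated n c om sigma n0; rewrite -/S /=.
move: sM M0 d0 normal0; move ME: (opnorm S) => M; move: (opnorm (commutator _ _)) => delta.
move=> sM M0 d0 normal0 approx.
have [dE|dE] := eqVneq delta 0.
  exists S; split; [exact: normal0 | by rewrite ME | by [] |].
  rewrite subrr opnorm0 !mulr_ge0 ?powR_ge0 ?sqrtr_ge0 //.
  by rewrite addr_ge0 ?divr_ge0 ?exprn_ge0.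
have {}d0 : 0 < delta by rewrite lt0r dE.
have [N [N1 N2 N3 N4]] := approx d0 sM om1.
exists N; split=> //.
  by move=> Sreal; apply: N3 => v; apply/om_real/realmx_shift.
have -> : S = shiftmx (fun v => om v * (Num.max (normc (c v)) sigma)%:C).
  by apply/matrixP => i j; rewrite !mxE max_l // -omc.
apply: le_trans N4 _; rewrite div1r powR12_sqrt ?(ltW d0) //.
have Ms0 : 0 <= M / sigma by rewrite divr_ge0 // ltW.
rewrite -mulrA -sqrtrM //; set x := M / sigma * delta.
have -> : M * (delta / (2 * sigma)) = x / 2.
  by rewrite /x; field; exact: lt0r_neq0.
have x0 : 0 <= x by rewrite mulr_ge0 // ltW.
have z0 : 0 <= Num.sqrt (x / 2) := sqrtr_ge0 _.
have w0 : 0 <= Num.sqrt x := sqrtr_ge0 _.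
have z2 : Num.sqrt (x / 2) ^+ 2 = x / 2 by rewrite sqr_sqrtr // divr_ge0.
have w2 : Num.sqrt x ^+ 2 = x by rewrite sqr_sqrtr.
move: (Num.sqrt (x / 2)) (Num.sqrt x) z0 w0 z2 w2 => z w z0 w0 z2 w2.
(* The factor obtained is [6 / sqrt 2 < 4.25]; the rational 4.8 between it and the claimed constant
   makes the comparison of squares simple. *)
have K0 : 48 / 10 <= 485 / 10 ^+ 2 + 73 / 10 ^+ 4 :> R by clear; lra.
apply: (@le_trans _ _ (48 / 10 * w)); last by rewrite ler_wpM2r.
rewrite -(@ler_pXn2r _ 2) ?nnegrE ?mulr_ge0 ?invr_ge0 // !exprMn z2 w2.
by move: x0; clear; lra.
Qed.

End WeightedShifts.

(** * Both estimates, with the decomposition into shifts drawn from normality *)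

Theorem theorem7p3p1 (R : realType) :
  (exists2 C : R, C < 533 / 10 ^+ 2 + 8 / 10 ^+ 4 &
    forall (n : nat) (S : 'M[R[i]]_n), (0 < n)%N ->
      (exists c : 'I_n -> R[i], weighted_shift_matrix c S) ->
      exists N : 'M[R[i]]_n,
        [/\ N \is normalmx,
            opnorm (N - S) <=
              C * opnorm S `^ (1 - 2 * (1 / 3))
                * opnorm (commutator (S^t*) S) `^ (1 / 3),
            equiv_sum_of_weighted_shifts N,
            opnorm N <= opnorm S
          & S \is a realmx -> N \is a realmx])
  /\
  (forall (n : nat) (S : 'M[R[i]]_n) (c : 'I_n -> R[i]) (sigma : R),
      (0 < n)%N ->
      weighted_shift_matrix c S ->
      0 < sigma ->
      (forall j, sigma <= Normc.normc (c j)) ->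
      exists N : 'M[R[i]]_n,
        [/\ N \is normalmx,
            equiv_sum_of_weighted_shifts N,
            opnorm N <= opnorm S,
            S \is a realmx -> N \is a realmx
          & opnorm (N - S) <=
              (485 / 10 ^+ 2 + 73 / 10 ^+ 4) * Num.sqrt (opnorm S / sigma)
                * opnorm (commutator (S^t*) S) `^ (1 / 2)]).
Proof.
split.
  exists (21 / 4) => [|n S n0 [c Sc]]; first by lra.
  have [N [N1 N2 N3 N4]] := shift_normal_approx n0 Sc.
  by exists N; split=> //; exact: normal_sum_of_shifts.
move=> n S c sigma n0 Sc s0 cs.
have [N [N1 N2 N3 N4]] := shift_normal_approx_bounded_below n0 Sc s0 cs.
by exists N; split=> //; exact: normal_sum_of_shifts.
Qed.
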